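(* For every $n\in\mathbb{N}$, the smallest $k\in\mathbb{N}$ such that \[\sup\Big\{\frac{\|z\|_{\pi,n}}{\|z\|_{ah,k}}\colon z\in\mathcal{S}\otimes\mathcal{S},\ z\neq0\Big\}<\infty\] equals $2n+1$.
   Context: Let $\mathbb{N}=\{1,2,\dots\}$. Let $s$ be the space of complex sequences $\xi=(\xi_j)_{j\geqslant1}$ with $|\xi|_n:=(\sum_{j}|\xi_j|^2j^{2n})^{1/2}<\infty$ for all $n\in\mathbb{N}$, and let $s'$ be its dual, the space of sequences $\eta$ with $|\eta|_n':=(\sum_j|\eta_j|^2j^{-2n})^{1/2}<\infty$ for some $n$, with pairing $\langle\xi,\eta\rangle=\sum_j\xi_j\overline{\eta_j}$. The noncommutative Schwartz space $\mathcal{S}=L(s',s)$ is the space of continuous linear operators $s'\to s$ with the topology of uniform convergence on bounded sets; it is a $*$-algebra with product $xy:=x\circ\iota\circ y$ ($\iota\colon s\hookrightarrow s'$ the inclusion) and involution given by $\langle x^*\xi,\eta\rangle=\langle\xi,x\eta\rangle$. For $n\in\mathbb{N}$ and $x\in\mathcal{S}$, $\|x\|_n:=\sup\{|x\xi|_n\colon \xi\in s',\ |\xi|_n'\leqslant1\}$. On the algebraic tensor product $\mathcal{S}\otimes\mathcal{S}$: $\|z\|_{\pi,n}:=\inf\sum_j\|x_j\|_n\|y_j\|_n$ and $\|z\|_{ah,n}:=\inf\|\sum_j|x_j|^2\|_n^{1/2}\|\sum_j|y_j|^2\|_n^{1/2}$, where $|x|^2:=\frac12(x^*x+xx^* )$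 and both infima run over all representations $z=\sum_{j=1}^mx_j\otimes y_j$. *)

(* Defs.v *)
From HB Require Import structures.
From mathcomp Require Import all_boot all_order all_algebra.
From mathcomp Require Import all_classical all_reals all_analysis.
From mathcomp Require Import complex.
From Stdlib Require Import ClassicalEpsilon.
Set Implicit Arguments. Unset Strict Implicit. Unset Printing Implicit Defensive.
Import Order.TTheory GRing.Theory Num.Theory.
Import numFieldTopology.Exports numFieldNormedType.Exports.
Local Open Scope classical_set_scope.
Local Open Scope ring_scope.

(* Conventions.  R : realType, complex scalars are R[i].  A complex sequence
   (xi_j)_{j >= 1} is represented by [xi : nat -> R[i]] with xi_j = xi (j-1);
   hence the weight j^n of the paper is ((i.+1)%:R)^n at index i. *)

(* The usual (metric) topology on the complex numbers R[i], |z - w| being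
   the modulus; needed for limits of complex series. *)
HB.instance Definition _ (R : rcfType) := PseudoPointedMetric.copy R[i] (R[i])^o.

Section SchwartzSpace.
Variable R : realType.
Local Notation C := R[i].
Definition cseq := nat -> C.

Local Open Scope ereal_scope.

(* |xi|_n^2 = sum_j |xi_j|^2 j^(2n)  and  (|eta|_n')^2 = sum_j |eta_j|^2 j^(-2n) *)
Definition snorm (n : nat) (xi : cseq) : \bar R :=
  sqrte (\esum_(j in [set: nat])
           ((Normc.normc (xi j) ^+ 2 * (j.+1)%:R ^+ (2 * n))%R)%:E).
Definition snorm' (n : nat) (eta : cseq) : \bar R :=
  sqrte (\esum_(j in [set: nat])
           ((Normc.normc (eta j) ^+ 2 / (j.+1)%:R ^+ (2 * n))%R)%:E).

(* the space s and its dual s' *)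
Definition in_s (xi : cseq) : Prop := forall n : nat, (0 < n)%N -> snorm n xi < +oo.
Definition in_s' (eta : cseq) : Prop := exists n : nat, (0 < n)%N /\ snorm' n eta < +oo.

(* the pairing <xi, eta> = sum_j xi_j conj(eta_j) *)
Definition pairing (xi eta : cseq) : C :=
  limn (series (fun j => xi j * (eta j)^*))%R.

(* raw operators on sequences (only their values on s' matter) *)
Definition rawop := cseq -> cseq.

(* ||x||_n = sup { |x xi|_n : xi in s', |xi|_n' <= 1 } *)
Definition opnorm (n : nat) (x : rawop) : \bar R :=
  ereal_sup [set snorm n (x xi) | xi in [set xi | in_s' xi /\ snorm' n xi <= 1]].

(* x is linear on s' *)
Definition linear_on_s' (x : rawop) : Prop :=
  forall (a : C) (xi eta : cseq), in_s' xi -> in_s' eta ->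
    x (fun j => a * xi j + eta j)%R = (fun j => a * x xi j + x eta j)%R.

End SchwartzSpace.

(* The noncommutative Schwartz space S = L(s', s): continuous linear operators
   s' -> s.  Continuity of a linear map s' -> s is expressed as boundedness:
   ||x||_n < oo for every n. *)
Record Sop (R : realType) := MkSop {
  sop :> rawop R;
  sop_lin : linear_on_s' sop;
  sop_range : forall xi, in_s' xi -> in_s (sop xi);
  sop_cont : forall n : nat, (0 < n)%N -> (opnorm n sop < +oo)%E
}.

Section Tensors.
Variable R : realType.
Local Notation C := R[i].
Local Open Scope ereal_scope.

(* the involution: adj x is determined on s' by <adj x xi, eta> = <xi, x eta> *)
Definition is_adjoint (x y : rawop R) : Prop :=
  forall xi eta : cseq R, in_s' xi -> in_s' eta ->
    pairing (y xi) eta = pairing xi (x eta).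

Definition adj (x : rawop R) : rawop R :=
  epsilon (inhabits (fun (_ : cseq R) (_ : nat) => (GRing.zero C))) (is_adjoint x).

(* |x|^2 = 1/2 (adj(x) x + x adj(x)); the product is composition (via s -> s') *)
Definition absq (x : rawop R) : rawop R :=
  fun xi j => (2^-1 * (adj x (x xi) j + x (adj x xi) j))%R.

(* An element of the algebraic tensor product S (x) S is given by a
   representation  sum_j x_j (x) y_j,  i.e. a list of pairs.  Two lists
   represent the same tensor iff their "kernels" agree, where
   (x (x) y)(xi, eta)(a, c) = (x xi)_a (y eta)_c  for xi, eta in s';
   this realization of S (x) S is injective. *)
Definition tens_eval (L : seq (Sop R * Sop R)) (xi eta : cseq R) (a c : nat) : C :=
  (\sum_(p <- L) sop p.1 xi a * sop p.2 eta c)%R.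

Definition same_tensor (L L' : seq (Sop R * Sop R)) : Prop :=
  forall (xi eta : cseq R) (a c : nat), in_s' xi -> in_s' eta ->
    tens_eval L xi eta a c = tens_eval L' xi eta a c.

Definition tensor_nonzero (L : seq (Sop R * Sop R)) : Prop :=
  exists (xi eta : cseq R) (a c : nat), [/\ in_s' xi, in_s' eta &
    tens_eval L xi eta a c <> 0%R].

(* ||z||_{pi,n} = inf sum_j ||x_j||_n ||y_j||_n over representations *)
Definition pi_norm (n : nat) (L : seq (Sop R * Sop R)) : \bar R :=
  ereal_inf [set (\sum_(p <- L') (opnorm n (sop p.1) * opnorm n (sop p.2)))
            | L' in [set L' | same_tensor L' L]].

Definition sum_absq (l : seq (Sop R)) : rawop R :=
  fun xi j => (\sum_(x <- l) absq (sop x) xi j)%R.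

(* ||z||_{ah,n} = inf ||sum_j |x_j|^2||_n^{1/2} ||sum_j |y_j|^2||_n^{1/2} *)
Definition ah_norm (n : nat) (L : seq (Sop R * Sop R)) : \bar R :=
  ereal_inf [set (sqrte (opnorm n (sum_absq (map fst L'))) *
                  sqrte (opnorm n (sum_absq (map snd L'))))
            | L' in [set L' | same_tensor L' L]].

(* sup { ||z||_{pi,n} / ||z||_{ah,k} : z <> 0 } < oo *)
Definition ratio_bounded (n k : nat) : Prop :=
  exists M : R, (0 < M)%R /\ forall L : seq (Sop R * Sop R), tensor_nonzero L ->
    pi_norm n L <= M%:E * ah_norm k L.

End Tensors.

(* Main.v *)
(* Write [x(a,c)] for the matrix entries of [x] and [D] for the diagonal matrix
   of the weights [j], so that [||x||_n] is the operator norm of [D^n x D^n].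

   Bound for k = 2n+1: no Grothendieck-type inequality is needed, every
   representation of [z] already does.  [||x||_n] is at most the
   Hilbert-Schmidt norm of [D^n x D^n], and AM-GM gives
     sum_x ||x||_n^2 <= sum_x sum_(a,c) a^2n c^2n |x(a,c)|^2
                     <= sum_a a^4n (sum_x |x|^2)(a,a)
                     <= ||sum_x |x|^2||_k sum_a a^(4n-2k),
   a convergent series.  Cauchy-Schwarz over the representation concludes.

   Failure for k <= 2n: take [z = sum_(N < b <= 2N) e_(ab) (x) e_(ab)], a single
   row [a].  The bilinear form [(x, y) |-> sum_b x(a,b) y(a,b)] shows
   [||z||_{pi,n} >= N a^2n N^2n], while [sum_b |e_(ab)|^2] is diagonal with norm
   at most [(2N)^2k + N a^2k].  Balancing the two terms by [N^(4n) = N a^(4n)]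
   makes the ratio unbounded. *)
Require Import Defs.
From HB Require Import structures.
From mathcomp Require Import all_boot all_order all_algebra.
From mathcomp Require Import all_classical all_reals all_analysis.
From mathcomp Require Import complex.
From mathcomp Require Import ring lra zify.
Set Implicit Arguments. Unset Strict Implicit. Unset Printing Implicit Defensive.
Import Order.TTheory GRing.Theory Num.Theory.
Import numFieldTopology.Exports numFieldNormedType.Exports.
Local Open Scope classical_set_scope.
Local Open Scope ring_scope.

(** * Weighted square sums and the sequence spaces [s] and [s'] *)

Section SequenceSpaces.
Variable R : realType.
Local Notation C := R[i].
Local Notation normc := (@Normc.normc R).
Implicit Types (xi eta u v : cseq R) (z : C).

Lemma normc_ge0 z : 0 <= normc z.
Proof. by case: z => a b; exact: sqrtr_ge0. Qed.

Lemma normc_sqr z : normc z ^+ 2 = complex.Re z ^+ 2 + complex.Im z ^+ 2.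
Proof. by case: z => a b /=; rewrite sqr_sqrtr // addr_ge0 ?sqr_ge0. Qed.

Lemma normc_conj z : normc (Num.conj z) = normc z.
Proof. by case: z => a b /=; rewrite sqrrN. Qed.

Lemma normc_real (r : R) : 0 <= r -> normc (r%:C)%C = r.
Proof. by move=> r0 /=; rewrite expr0n addr0 sqrtr_sqr ger0_norm. Qed.

Lemma normr_Re_le z : `|complex.Re z| <= normc z.
Proof.
rewrite -ler_sqr ?nnegrE ?normc_ge0// real_normK ?num_real//.
by rewrite normc_sqr lerDl sqr_ge0.
Qed.

Lemma normr_Im_le z : `|complex.Im z| <= normc z.
Proof.
rewrite -ler_sqr ?nnegrE ?normc_ge0// real_normK ?num_real//.
by rewrite normc_sqr lerDr sqr_ge0.
Qed.

Lemma mul_conjc z : z * Num.conj z = ((normc z ^+ 2)%:C)%C.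
Proof.
rewrite normc_sqr; case: z => a b; apply/eqP.
by rewrite eq_complex /=; apply/andP; split; apply/eqP; ring.
Qed.

(** Lagrange's identity: the double sum of [(a i * b j - a j * b i) ^+ 2] is twice the defect in the
    Cauchy-Schwarz inequality. *)
Lemma sum_mul_sqr_le (I : Type) (r : seq I) (a b : I -> R) :
  (\sum_(i <- r) a i * b i) ^+ 2 <=
  (\sum_(i <- r) a i ^+ 2) * (\sum_(i <- r) b i ^+ 2).
Proof.
have : 0 <= \sum_(i <- r) \sum_(j <- r) (a i * b j - a j * b i) ^+ 2.
  by apply: sumr_ge0 => i _; apply: sumr_ge0 => j _; exact: sqr_ge0.
have -> : \sum_(i <- r) \sum_(j <- r) (a i * b j - a j * b i) ^+ 2 =
   (\sum_(i <- r) a i ^+ 2) * (\sum_(j <- r) b j ^+ 2)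
   - 2 * (\sum_(i <- r) a i * b i) * (\sum_(j <- r) a j * b j)
   + (\sum_(i <- r) b i ^+ 2) * (\sum_(j <- r) a j ^+ 2).
  transitivity (\sum_(i <- r) (a i ^+ 2 * (\sum_(j <- r) b j ^+ 2)
      + (- 2 * (a i * b i)) * (\sum_(j <- r) a j * b j)
      + b i ^+ 2 * (\sum_(j <- r) a j ^+ 2))).
    apply: eq_bigr => i _; rewrite !mulr_sumr -!big_split /=.
    by apply: eq_bigr => j _; ring.
  by rewrite !big_split /= -!mulr_suml -mulr_sumr !mulNr.
rewrite expr2; set A := \sum_(i <- r) a i ^+ 2.
set B := \sum_(i <- r) b i ^+ 2; nra.
Qed.

Lemma sum_mul_le (I : Type) (r : seq I) (a b : I -> R) (A B : R) :
  0 <= A -> 0 <= B ->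
  \sum_(i <- r) a i ^+ 2 <= A ^+ 2 -> \sum_(i <- r) b i ^+ 2 <= B ^+ 2 ->
  \sum_(i <- r) a i * b i <= A * B.
Proof.
move=> A0 B0 hA hB; rewrite (le_trans (ler_norm _))//.
rewrite -ler_sqr ?nnegrE ?mulr_ge0// real_normK ?num_real//.
rewrite (le_trans (sum_mul_sqr_le _ _ _))// exprMn ler_pM//;
by apply: sumr_ge0 => i _; exact: sqr_ge0.
Qed.

Lemma sum_inv_sqr_le (N : nat) :
  \sum_(0 <= j < N) ((j.+1)%:R ^+ 2)^-1 <= 2 :> R.
Proof.
(* The constant 2 alone does not pass through an induction; [2 - 1/(N+1)] does, because
   [1/(N+2)^2 <= 1/(N+1) - 1/(N+2)]. *)
suff : \sum_(0 <= j < N.+1) ((j.+1)%:R ^+ 2)^-1 <= 2 - (N.+1%:R)^-1 :> R.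
  move=> h; have /= h2 := le_trans h (_ : _ <= 2).
  rewrite (le_trans _ (h2 _)) ?big_nat_recr//= ?lerDl ?invr_ge0 ?exprn_ge0//.
  by rewrite gerDl oppr_le0 invr_ge0.
elim: N => [|N IH].
  by rewrite big_nat1 expr1n invr1; lra.
rewrite big_nat_recr //= (le_trans (lerD IH (lexx _)))//.
have h : 0 < N.+1%:R :> R by rewrite ltr0n.
rewrite -[N.+2]addn1 natrD; set x : R := N.+1%:R in h *.
rewrite -subr_ge0 (_ : _ - _ = (x * (x + 1) ^+ 2)^-1).
  by rewrite invr_ge0 mulr_ge0 ?exprn_ge0 //; lra.
by field; apply/andP; split; lra.
Qed.

(** Partial sums of a squared weighted norm. A bound by [K ^+ 2] uniform in [N] stands for the
    extended-real inequality [norm <= K], so that all later estimates concern finite real sums. *)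
Definition sqsum (w : nat -> R) (xi : cseq R) (N : nat) : R :=
  \sum_(0 <= j < N) normc (xi j) ^+ 2 * w j.

Lemma sqsum_le w xi (N M : nat) : (forall j, 0 <= w j) -> (N <= M)%N ->
  sqsum w xi N <= sqsum w xi M.
Proof.
move=> w0 NM; rewrite /sqsum [leRHS](big_cat_nat (leq0n N) NM) /= lerDl.
by apply: sumr_ge0 => j _; rewrite mulr_ge0 ?sqr_ge0.
Qed.

Lemma term_le_sqsum w xi j : (forall j, 0 <= w j) ->
  normc (xi j) ^+ 2 * w j <= sqsum w xi j.+1.
Proof.
move=> w0; rewrite /sqsum big_nat_recr //= lerDr.
by apply: sumr_ge0 => i _; rewrite mulr_ge0 ?sqr_ge0.
Qed.

Lemma sqrte_esum_le w xi (K : R) : (forall j, 0 <= w j) -> 0 <= K ->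
  (sqrte (\esum_(j in [set: nat]) (normc (xi j) ^+ 2 * w j)%:E) <= K%:E)%E <->
  forall N, sqsum w xi N <= K ^+ 2.
Proof.
move=> w0 K0.
have h0 j : (0 <= (normc (xi j) ^+ 2 * w j)%:E)%E.
  by rewrite lee_fin mulr_ge0 ?sqr_ge0.
have -> : K%:E = sqrte ((K ^+ 2)%:E) by rewrite /= sqrtr_sqr ger0_norm.
rewrite lee_sqrt ?lee_fin ?sqr_ge0// -nneseries_esumT//; split => [h N|h].
  rewrite -lee_fin (le_trans _ h)// /sqsum -sumEFin.
  by apply: nneseries_lim_ge.
apply: lime_le; first exact: is_cvg_nneseries.
by near=> N; rewrite sumEFin lee_fin; exact: h.
Unshelve. all: by end_near. Qed.

Lemma sweight_ge0 (n j : nat) : 0 <= (j.+1)%:R ^+ (2 * n) :> R.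
Proof. exact: exprn_ge0. Qed.

Lemma sweight'_ge0 (n j : nat) : 0 <= ((j.+1)%:R ^+ (2 * n))^-1 :> R.
Proof. by rewrite invr_ge0 exprn_ge0. Qed.

Definition ssum n := sqsum (fun j => (j.+1)%:R ^+ (2 * n)).
Definition ssum' n := sqsum (fun j => ((j.+1)%:R ^+ (2 * n))^-1).

Lemma snormP n xi (K : R) : 0 <= K ->
  (snorm n xi <= K%:E)%E <-> forall N, ssum n xi N <= K ^+ 2.
Proof. by move=> K0; apply: sqrte_esum_le => // j; exact: sweight_ge0. Qed.

Lemma snorm'P n xi (K : R) : 0 <= K ->
  (snorm' n xi <= K%:E)%E <-> forall N, ssum' n xi N <= K ^+ 2.
Proof. by move=> K0; apply: sqrte_esum_le => // j; exact: sweight'_ge0. Qed.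

Lemma lt_pinfty_bound (e : \bar R) : (0 <= e)%E -> (e < +oo)%E ->
  exists2 K : R, 0 < K & (e <= K%:E)%E.
Proof.
case: e => // r; rewrite lee_fin => r0 _; exists (r + 1); first lra.
by rewrite lee_fin; lra.
Qed.

Lemma in_sP xi : in_s xi <->
  forall n, (0 < n)%N -> exists2 K : R, 0 < K & forall N, ssum n xi N <= K ^+ 2.
Proof.
split => h n n0.
  have [K K0 hK] := lt_pinfty_bound (sqrte_ge0 _) (h n n0).
  by exists K => //; apply/snormP => //; exact: ltW.
have [K K0 hK] := h n n0.
by apply: (le_lt_trans _ (ltry K)); apply/snormP => //; exact: ltW.
Qed.

Lemma in_s'P xi : in_s' xi <-> exists2 n, (0 < n)%N &
  exists2 K : R, 0 < K & forall N, ssum' n xi N <= K ^+ 2.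
Proof.
split => [[n [n0 hn]]|[n n0 [K K0 hK]]].
  have [K K0 hK] := lt_pinfty_bound (sqrte_ge0 _) hn.
  by exists n => //; exists K => //; apply/snorm'P => //; exact: ltW.
exists n; split => //.
by apply: (le_lt_trans _ (ltry K)); apply/snorm'P => //; exact: ltW.
Qed.

Lemma ssum'_level_le m n xi N : (m <= n)%N -> ssum' n xi N <= ssum' m xi N.
Proof.
move=> mn; apply: ler_sum => j _; apply: ler_wpM2l; first exact: sqr_ge0.
rewrite lef_pV2 ?posrE ?exprn_gt0// ler_weXn2l ?ler1n//.
by rewrite leq_mul2l mn orbT.
Qed.

Lemma ssum'_le_ssum m n xi N : ssum' m xi N <= ssum n xi N.
Proof.
apply: ler_sum => j _; apply: ler_wpM2l; first exact: sqr_ge0.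
have h k : 1 <= (j.+1)%:R ^+ k :> R by rewrite exprn_ege1 ?ler1n.
by rewrite (le_trans _ (h _))// invf_le1 ?exprn_gt0.
Qed.

Lemma in_s_in_s' xi : in_s xi -> in_s' xi.
Proof.
move=> /in_sP /(_ 1%N isT)[K K0 h]; apply/in_s'P; exists 1%N => //; exists K => // N.
exact: le_trans (ssum'_le_ssum _ _ _ _) (h N).
Qed.

End SequenceSpaces.

(** * Convergence in the complex numbers and the pairing of sequences *)

Section Pairing.
Variable R : realType.
Local Notation C := R[i].
Local Notation normc := (@Normc.normc R).
Implicit Types (xi eta u v : cseq R) (z l : C).

Lemma normc_def z : `|z| = ((normc z)%:C)%C.
Proof. by case: z. Qed.

(** The norm on [C] takes its values in [C] itself; this form has a real modulus and a real [e]. *)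
Lemma cvg_normcP (u : nat -> C) l : (u @ \oo --> l) <->
  forall e : R, 0 < e -> \forall n \near \oo, normc (l - u n) < e.
Proof.
split => [h e e0|h].
  have eC : 0 < (e%:C)%C by rewrite ltcR.
  have : \forall n \near \oo, `|l - u n| < (e%:C)%C.
    exact: (@cvgrPdist_lt C C^o nat \oo _ u l).1 h _ eC.
  apply: filterS => n.
  by rewrite normc_def ltcR.
apply: (@cvgrPdist_lt C C^o nat \oo _ u l).2 => e e0.
have eR : e = ((complex.Re e)%:C)%C by rewrite RRe_real // gtr0_real.
rewrite eR; move: e0; rewrite eR ltcR => /h; apply: filterS => n.
by rewrite normc_def ltcR.
Qed.

Lemma cvgC_lim (u : nat -> C) l : u @ \oo --> l -> limn u = l.
Proof. by apply: cvg_lim; exact: (@norm_hausdorff C C^o). Qed.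

Lemma cvgCD (u v : nat -> C) l m : u @ \oo --> l -> v @ \oo --> m ->
  (fun n => u n + v n) @ \oo --> l + m.
Proof. exact: (@cvgD C C^o). Qed.

Lemma cvgCZ (a : C) (u : nat -> C) l : u @ \oo --> l ->
  (fun n => a * u n) @ \oo --> a * l.
Proof. exact: (@cvgZl_tmp C C^o). Qed.

Lemma cvgC_conj (u : nat -> C) l : u @ \oo --> l ->
  (fun n => Num.conj (u n)) @ \oo --> Num.conj l.
Proof.
move=> /cvg_normcP h; apply/cvg_normcP => e e0.
by apply: filterS (h e e0) => n; rewrite -rmorphB normc_conj.
Qed.

Lemma cvgC_Re (u : nat -> C) l : u @ \oo --> l ->
  (fun n => complex.Re (u n)) @ \oo --> complex.Re l.
Proof.
move=> /cvg_normcP h; apply/cvgrPdist_lt => e e0.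
apply: filterS (h e e0) => n; apply: le_lt_trans.
by rewrite -raddfB; exact: normr_Re_le.
Qed.

Lemma cvgC_Im (u : nat -> C) l : u @ \oo --> l ->
  (fun n => complex.Im (u n)) @ \oo --> complex.Im l.
Proof.
move=> /cvg_normcP h; apply/cvgrPdist_lt => e e0.
apply: filterS (h e e0) => n; apply: le_lt_trans.
by rewrite -raddfB; exact: normr_Im_le.
Qed.

Lemma cvgC_normc_sqr (u : nat -> C) l : u @ \oo --> l ->
  (fun n => normc (u n) ^+ 2) @ \oo --> normc l ^+ 2.
Proof.
move=> h; rewrite normc_sqr; under eq_fun do rewrite normc_sqr.
by apply: cvgD; rewrite !expr2; apply: cvgM;
  (exact: cvgC_Re) || exact: cvgC_Im.
Qed.

Lemma cvgC_of_parts (a b : nat -> R) (la lb : R) :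
  a @ \oo --> la -> b @ \oo --> lb ->
  (fun n => (a n +i* b n)%C) @ \oo --> (la +i* lb)%C.
Proof.
move=> /cvgrPdist_lt ha /cvgrPdist_lt hb; apply/cvg_normcP => e e0.
have e20 : 0 < e / 2 by lra.
near=> n.
have ha1 : `|la - a n| < e / 2 by near: n; exact: ha.
have hb1 : `|lb - b n| < e / 2 by near: n; exact: hb.
rewrite -ltr_sqr ?nnegrE ?normc_ge0 ?(ltW e0)// normc_sqr /=.
rewrite -[X in X + _ < _](real_normK (num_real _)).
rewrite -[X in _ + X < _](real_normK (num_real _)).
have := normr_ge0 (la - a n); have := normr_ge0 (lb - b n).
move: ha1 hb1; set x := `|la - a n|; set y := `|lb - b n|; nra.
Unshelve. all: by end_near. Qed.

(** Absolute convergence: the real and the imaginary parts are each dominated by the modulus, and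
    the two real limits are put together. *)
Lemma cvg_series_normc (u : nat -> C) (M : R) :
  (forall N, \sum_(0 <= j < N) normc (u j) <= M) -> cvgn (series u).
Proof.
move=> hM.
have h : cvgn (series (fun j => normc (u j))).
  apply: nondecreasing_is_cvgn.
    by apply: nondecreasing_series => j _ _; exact: normc_ge0.
  by exists M => _ [N _ <-]; exact: hM.
have hp (p : {additive Rcomplex R -> R}) : (forall z, `|p z| <= normc z) ->
    cvgn (series (fun j => p (u j))).
  move=> hpn; apply: normed_cvg; apply: series_le_cvg h => // j.
  - exact: normr_ge0.
  - exact: normc_ge0.
  - exact: hpn.
have hRe : cvgn (series (fun j => complex.Re (u j))).
  by apply: hp; exact: normr_Re_le.
have hIm : cvgn (series (fun j => complex.Im (u j))).
  by apply: (hp (@complex.Im R)); exact: normr_Im_le.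
apply/cvg_ex; exists (limn (series (fun j => complex.Re (u j))) +i*
  limn (series (fun j => complex.Im (u j))))%C.
rewrite (_ : series u = fun N => (series (fun j => complex.Re (u j)) N +i*
    series (fun j => complex.Im (u j)) N)%C).
  exact: cvgC_of_parts.
apply/funext => N; apply/eqP.
by rewrite eq_complex /= /series /= !raddf_sum !eqxx.
Qed.

Section Bounds.
Variables (w : nat -> R) (A B : R) (u v : cseq R).
Hypotheses (w_gt0 : forall j, 0 < w j) (A0 : 0 <= A) (B0 : 0 <= B).
Hypothesis hu : forall N, sqsum w u N <= A ^+ 2.
Hypothesis hv : forall N, sqsum (fun j => (w j)^-1) v N <= B ^+ 2.

(** Cauchy-Schwarz after moving [sqrt (w j)] from one factor to the other. The weight stays general
    because two cases are needed: [w j = (j+1)^(-2m)], which pairs [s'] with [s], and [w = 1], the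
    plain Hilbert space of square-summable sequences. *)
Lemma sum_normc_mul_le N : \sum_(0 <= j < N) normc (u j * Num.conj (v j)) <= A * B.
Proof.
rewrite (eq_bigr (fun j => (normc (u j) * Num.sqrt (w j)) *
    (normc (v j) / Num.sqrt (w j)))); last first.
  move=> j _; rewrite Normc.normcM normc_conj; field.
  by rewrite gt_eqF // sqrtr_gt0.
apply: sum_mul_le => //.
  rewrite (le_trans _ (hu N))//; apply: ler_sum => j _.
  by rewrite exprMn sqr_sqrtr // ltW.
rewrite (le_trans _ (hv N))//; apply: ler_sum => j _.
by rewrite exprMn exprVn sqr_sqrtr // ltW.
Qed.

Lemma cvg_pairing :
  series (fun j => u j * Num.conj (v j)) @ \oo --> pairing u v.
Proof. exact: cvg_series_normc sum_normc_mul_le. Qed.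

Lemma normc_pairing_le : normc (pairing u v) <= A * B.
Proof.
rewrite -ler_sqr ?nnegrE ?normc_ge0 ?mulr_ge0//.
have h := cvgC_normc_sqr cvg_pairing.
rewrite -(cvg_lim _ h)//; apply: limr_le; first by apply/cvg_ex; eexists; exact: h.
near=> N; rewrite ler_sqr ?nnegrE ?normc_ge0 ?mulr_ge0//.
apply: le_trans (sum_normc_mul_le N).
rewrite /series /=; elim/big_ind2 : _ => //; first by rewrite Normc.normc0.
by move=> x a y b hx hy; rewrite (le_trans (le_normcD _ _))// lerD.
Unshelve. all: by end_near. Qed.

End Bounds.

End Pairing.

(** * Operators from [s'] to [s]: truncation, continuity and adjoints *)

Section Operators.
Variable R : realType.
Local Notation C := R[i].
Local Notation normc := (@Normc.normc R).
Implicit Types (xi eta u v : cseq R) (z l : C).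

Definition trunc (N : nat) xi : cseq R := fun j => if (j < N)%N then xi j else 0.
Definition evec (c : nat) : cseq R := fun j => (j == c)%:R.

(** Written in the shape [a * xi j + eta j] of [linear_on_s'], so that operators can be evaluated on
    truncations by induction on [N]. *)
Lemma truncS N xi : trunc N.+1 xi = (fun j => xi N * evec N j + trunc N xi j).
Proof.
apply/funext => j; rewrite /trunc /evec ltnS leq_eqVlt.
by case: ltngtP => [jN|jN|->]; rewrite /= ?mulr0 ?mulr1 ?add0r ?addr0.
Qed.

Lemma trunc0 xi : trunc 0 xi = (fun=> 0).
Proof. by apply/funext. Qed.

Lemma sqsum_lin_le w (a : C) xi eta N : (forall j, 0 <= w j) ->
  sqsum w (fun j => a * xi j + eta j) N <=
  2 * (normc a ^+ 2 * sqsum w xi N + sqsum w eta N).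
Proof.
move=> w0; rewrite /sqsum mulr_sumr -big_split mulr_sumr /=; apply: ler_sum => j _.
rewrite [X in 2 * (X + _)]mulrA -mulrDl [leRHS]mulrA; apply: ler_wpM2r => //.
rewrite -exprMn -Normc.normcM.
have := le_normcD (a * xi j) (eta j).
have := normc_ge0 (a * xi j + eta j).
have := sqr_ge0 (normc (a * xi j) - normc (eta j)).
set x := normc (_ + _); set y := normc (a * _); set z := normc (eta j); nra.
Qed.

Lemma in_s'_common xi eta : in_s' xi -> in_s' eta ->
  exists2 m, (0 < m)%N & exists A B : R, [/\ 0 < A, 0 < B,
    forall N, ssum' m xi N <= A ^+ 2 & forall N, ssum' m eta N <= B ^+ 2].
Proof.
move=> /in_s'P[m m0 [A A0 hA]] /in_s'P[n n0 [B B0 hB]].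
exists (maxn m n); first by rewrite leq_max m0.
exists A, B; split => // N.
  by rewrite (le_trans _ (hA N))// ssum'_level_le // leq_maxl.
by rewrite (le_trans _ (hB N))// ssum'_level_le // leq_maxr.
Qed.

Lemma in_s'_lin (a : C) xi eta : in_s' xi -> in_s' eta ->
  in_s' (fun j => a * xi j + eta j).
Proof.
move=> hxi heta; have [m m0 [A [B [A0 B0 hA hB]]]] := in_s'_common hxi heta.
apply/in_s'P; exists m => //.
have h0 : 0 <= normc a ^+ 2 by exact: sqr_ge0.
(* The square sums are at most [2 * K] with [K] the bracket; the summand 1 ensures [1 <= K], hence
   [2 * K <= (2 * K) ^+ 2]. *)
exists (2 * (1 + normc a ^+ 2 * A ^+ 2 + B ^+ 2)).
  by have := sqr_ge0 A; have := sqr_ge0 B; nra.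
move=> N; apply: (le_trans (sqsum_lin_le _ _ _ _ (sweight'_ge0 R m))).
set K := 1 + _ + _.
have K1 : 1 <= K by rewrite /K; have := sqr_ge0 A; have := sqr_ge0 B; nra.
have : normc a ^+ 2 * ssum' m xi N + ssum' m eta N <= K.
  have := ler_wpM2l h0 (hA N); have := hB N; rewrite /K; lra.
rewrite /ssum'; set T := (_ + _); nra.
Qed.

Lemma sqsum_evec_le w (b : C) c N : (forall j, 0 <= w j) ->
  sqsum w (fun j => b * evec c j) N <= normc b ^+ 2 * w c.
Proof.
move=> w0; rewrite (le_trans (sqsum_le _ w0 (leq_maxr c.+1 N)))// /sqsum.
have h j : j != c -> normc (b * evec c j) ^+ 2 * w j = 0.
  by move=> /negbTE jc; rewrite /evec jc mulr0 Normc.normc0 expr0n mul0r.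
rewrite (bigD1_seq c) ?iota_uniq//=; last first.
  by rewrite mem_index_iota leq0n leq_max ltnSn.
by rewrite big1 // addr0 /evec eqxx mulr1.
Qed.

Lemma in_s'0 : in_s' (fun=> 0 : C).
Proof.
apply/in_s'P; exists 1%N => //; exists 1 => // N.
rewrite /ssum' /sqsum big1 ?expr1n// => j _.
by rewrite Normc.normc0 expr0n mul0r.
Qed.

Lemma in_s'Z (a : C) xi : in_s' xi -> in_s' (fun j => a * xi j).
Proof.
move=> hxi; have := in_s'_lin a hxi in_s'0.
by congr in_s'; apply/funext => j; rewrite addr0.
Qed.

Lemma in_s'_evec c : in_s' (evec c).
Proof.
apply/in_s'P; exists 1%N => //; exists 1 => // N.
have := @sqsum_evec_le _ 1 c N (sweight'_ge0 R 1).
rewrite (_ : (fun j => 1 * evec c j) = evec c); last first.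
  by apply/funext => j; rewrite mul1r.
move=> /le_trans; apply; rewrite Normc.normc1 expr1n mul1r invf_le1 ?exprn_gt0//.
by rewrite exprn_ege1 ?ler1n.
Qed.

Lemma in_s'_trunc N xi : in_s' (trunc N xi).
Proof.
elim: N => [|N IH]; first by rewrite trunc0; exact: in_s'0.
by rewrite truncS; apply: in_s'_lin => //; exact: in_s'_evec.
Qed.

Lemma sop0 (x : Sop R) : sop x (fun=> 0) = (fun=> 0).
Proof.
have := sop_lin x 1 in_s'0 in_s'0.
rewrite (_ : (fun j : nat => 1 * 0 + 0) = (fun=> 0 : C)); last first.
  by apply/funext => j; rewrite mulr0 addr0.
move=> /(congr1 (fun f => f _)) h; apply/funext => j.
have := h j; rewrite mul1r => /eqP.
by rewrite -[X in X == _]addr0 (inj_eq (addrI _)) => /eqP.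
Qed.

Lemma sopZ (x : Sop R) a xi : in_s' xi ->
  sop x (fun j => a * xi j) = (fun j => a * sop x xi j).
Proof.
move=> hxi; have := sop_lin x a hxi in_s'0.
rewrite (_ : (fun j => a * xi j + 0) = (fun j => a * xi j)); last first.
  by apply/funext => j; rewrite addr0.
by move=> ->; apply/funext => j; rewrite sop0 addr0.
Qed.

Lemma sop_trunc (x : Sop R) N eta i :
  sop x (trunc N eta) i = \sum_(0 <= c < N) eta c * sop x (evec c) i.
Proof.
elim: N => [|N IH]; first by rewrite trunc0 sop0 big_nil.
rewrite truncS sop_lin; [|exact: in_s'_evec|exact: in_s'_trunc].
by rewrite IH big_nat_recr //= addrC.
Qed.

Lemma opnorm_ge0 n (x : rawop R) : (0 <= opnorm n x)%E.
Proof.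
apply: (@le_trans _ _ (snorm n (x (fun=> 0)))); first exact: sqrte_ge0.
apply: ereal_sup_ubound; exists (fun=> 0) => //; split; first exact: in_s'0.
apply/snorm'P => // N; rewrite /ssum' /sqsum big1 ?expr1n// => j _.
by rewrite Normc.normc0 expr0n mul0r.
Qed.

Lemma opnorm_apply1 n (x : rawop R) (K : R) xi : 0 <= K ->
  (opnorm n x <= K%:E)%E -> in_s' xi -> (forall N, ssum' n xi N <= 1) ->
  forall N, ssum n (x xi) N <= K ^+ 2.
Proof.
move=> K0 hK hxi h1; apply/snormP => //; apply: le_trans hK.
apply: ereal_sup_ubound; exists xi => //; split => //.
by apply/snorm'P => // N; rewrite expr1n.
Qed.

Lemma opnorm_le n (x : rawop R) (K : R) : 0 <= K ->
  (forall xi, in_s' xi -> (forall N, ssum' n xi N <= 1) ->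
    forall N, ssum n (x xi) N <= K ^+ 2) ->
  (opnorm n x <= K%:E)%E.
Proof.
move=> K0 h; apply: ub_ereal_sup => _ [xi [hxi /snorm'P h1] <-].
by apply/snormP => // N; apply: h => // M; rewrite (le_trans (h1 _ _))// expr1n.
Qed.

Lemma sqsumZ w (a : C) xi N :
  sqsum w (fun j => a * xi j) N = normc a ^+ 2 * sqsum w xi N.
Proof.
rewrite /sqsum mulr_sumr; apply: eq_bigr => j _.
by rewrite Normc.normcM exprMn mulrA.
Qed.

Lemma opnorm_apply n (x : Sop R) (K A : R) xi : 0 <= K -> 0 < A ->
  (opnorm n (sop x) <= K%:E)%E -> in_s' xi -> (forall N, ssum' n xi N <= A ^+ 2) ->
  forall N, ssum n (sop x xi) N <= (K * A) ^+ 2.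
Proof.
move=> K0 A0 hK hxi hA N.
have nA : normc ((A^-1)%:C)%C = A^-1 by rewrite normc_real // invr_ge0 ltW.
have hin := in_s'Z (A^-1)%:C%C hxi.
have h1 M : ssum' n (fun j => (A^-1)%:C%C * xi j) M <= 1.
  by rewrite /ssum' sqsumZ nA exprVn mulrC ler_pdivrMr ?exprn_gt0 // mul1r; exact: hA.
have := opnorm_apply1 K0 hK hin h1 N.
rewrite sopZ // /ssum sqsumZ nA exprVn mulrC => h.
by rewrite exprMn -ler_pdivrMr ?exprn_gt0.
Qed.

Lemma sop_bound n (x : Sop R) : (0 < n)%N ->
  exists2 K : R, 0 < K & (opnorm n (sop x) <= K%:E)%E.
Proof. by move=> n0; apply: lt_pinfty_bound (opnorm_ge0 _ _) (sop_cont x n0). Qed.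

(** The square sum of the truncation error is a difference of partial sums of a convergent series,
    hence at most the limit minus the [N]-th partial sum, whatever [M] is. The factor [-1 *] again
    fits [linear_on_s']. *)
Lemma sqsum_tail w xi (A e : R) : (forall j, 0 <= w j) -> 0 < e ->
  (forall N, sqsum w xi N <= A ^+ 2) ->
  \forall N \near \oo, forall M,
    sqsum w (fun j => -1 * trunc N xi j + xi j) M <= e ^+ 2.
Proof.
move=> w0 e0 hA.
have hc : cvgn (sqsum w xi).
  apply: nondecreasing_is_cvgn; first by move=> m n mn; exact: sqsum_le.
  by exists (A ^+ 2) => _ [N _ <-].
have e20 : 0 < e ^+ 2 by rewrite exprn_gt0.
move/cvgrPdist_lt : (hc) => /(_ _ e20); apply: filterS => N hN M.
have hM : sqsum w xi (maxn N M) <= limn (sqsum w xi).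
  by apply: nondecreasing_cvgn_le => // m n mn; exact: sqsum_le.
have hh : sqsum w (fun j => -1 * trunc N xi j + xi j) (maxn N M) =
    sqsum w xi (maxn N M) - sqsum w xi N.
  rewrite /sqsum (big_cat_nat (leq0n N) (leq_maxl N M))/=.
  rewrite [X in _ = X - _](big_cat_nat (leq0n N) (leq_maxl N M))/=.
  rewrite big_nat_cond big1 ?add0r; last first.
    move=> j /andP[/andP[_ jN] _].
    by rewrite /trunc jN mulN1r addNr Normc.normc0 expr0n mul0r.
  rewrite addrAC subrr add0r; apply: eq_big_nat => j /andP[jN _].
  by rewrite /trunc ltnNge jN mulr0 add0r.
apply: (le_trans (sqsum_le _ w0 (leq_maxr N M))); rewrite hh.
apply: ltW; apply: le_lt_trans hN; apply: le_trans (ler_norm _).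
by rewrite lerD2r.
Qed.

Lemma pairing_lin_r m u v v' (a : C) : in_s v -> in_s v' -> (0 < m)%N ->
  (exists2 A : R, 0 < A & forall N, ssum' m u N <= A ^+ 2) ->
  pairing u (fun j => a * v j + v' j) = Num.conj a * pairing u v + pairing u v'.
Proof.
move=> /in_sP hv /in_sP hv' m0 [A A0 hA].
have w0 j : 0 < ((j.+1)%:R ^+ (2 * m))^-1 :> R by rewrite invr_gt0 exprn_gt0.
have hs t : in_s t -> series (fun j => u j * Num.conj (t j)) @ \oo --> pairing u t.
  move=> /in_sP/(_ m m0) [B B0 hB].
  apply: (cvg_pairing w0 (ltW A0) (ltW B0) hA) => N.
  by rewrite /sqsum; under eq_bigr do rewrite invrK; exact: hB.
have h := cvgCD (cvgCZ (a := Num.conj a) (hs _ ((in_sP _).2 hv))) (hs _ ((in_sP _).2 hv')).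
rewrite -(cvgC_lim h); congr (limn _); apply/funext => N.
rewrite /series /= mulr_sumr -big_split; apply: eq_bigr => j _ /=.
by rewrite rmorphD rmorphM; ring.
Qed.

Lemma normc_pairing_s's m u v (A B : R) : 0 <= A -> 0 <= B ->
  (forall N, ssum' m u N <= A ^+ 2) -> (forall N, ssum m v N <= B ^+ 2) ->
  normc (pairing u v) <= A * B.
Proof.
move=> A0 B0 hA hB.
have w0 j : 0 < ((j.+1)%:R ^+ (2 * m))^-1 :> R by rewrite invr_gt0 exprn_gt0.
apply: (normc_pairing_le w0 A0 B0 hA) => N.
by rewrite /sqsum; under eq_bigr do rewrite invrK; exact: hB.
Qed.

Lemma pairing_eventually0 u v N :
  (forall j, (N <= j)%N -> u j * Num.conj (v j) = 0) ->
  pairing u v = \sum_(0 <= j < N) u j * Num.conj (v j).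
Proof.
move=> h; apply: cvgC_lim; apply/cvg_normcP => e e0.
exists N => // M /= NM; rewrite /series /= (big_cat_nat (leq0n N) NM)/=.
have -> : \sum_(N <= j < M) u j * Num.conj (v j) = 0.
  by rewrite big_nat_cond big1 // => j /andP[/andP[/h]].
by rewrite addr0 subrr Normc.normc0.
Qed.

Lemma pairing_evec_r (b : C) u c :
  pairing u (fun j => b * evec c j) = u c * Num.conj b.
Proof.
rewrite (@pairing_eventually0 _ _ c.+1) => [|j cj].
  rewrite big_nat_recr //= big_nat_cond big1 ?add0r.
    by rewrite /evec eqxx mulr1.
  by move=> j /andP[/andP[_ jc] _]; rewrite /evec ltn_eqF // mulr0 rmorph0 mulr0.
by rewrite /evec gtn_eqF // mulr0 rmorph0 mulr0.
Qed.

Lemma pairing_evec_l (a : C) v c :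
  pairing (fun j => a * evec c j) v = a * Num.conj (v c).
Proof.
rewrite (@pairing_eventually0 _ _ c.+1) => [|j cj].
  rewrite big_nat_recr //= big_nat_cond big1 ?add0r.
    by rewrite /evec eqxx mulr1.
  by move=> j /andP[/andP[_ jc] _]; rewrite /evec ltn_eqF // mulr0 mul0r.
by rewrite /evec gtn_eqF // mulr0 mul0r.
Qed.

(** At a level [m] where [xi] and [eta] both have finite dual norm, the tails of [eta] tend to 0.
    The operator [x] maps them to small elements of [s], and pairing with [xi] is continuous
    there. *)
Lemma cvg_pairing_trunc (x : Sop R) xi eta : in_s' xi -> in_s' eta ->
  (fun N => pairing xi (sop x (trunc N eta))) @ \oo --> pairing xi (sop x eta).
Proof.
move=> hxi heta; have [m m0 [A [B [A0 B0 hA hB]]]] := in_s'_common hxi heta.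
have [K K0 hK] := sop_bound x m0.
apply/cvg_normcP => e e0.
(* A tail of dual norm [e / (2AK)] has an image of norm at most [e / (2A)], so the pairing changes
   by at most [e / 2]. *)
have d0 : 0 < e / (2 * A * K) by rewrite divr_gt0 // !mulr_gt0.
apply: filterS (sqsum_tail (sweight'_ge0 R m) d0 hB) => N hN.
have ht := in_s'_trunc N eta.
have hlin := sop_lin x (-1) ht heta.
have hu : exists2 A : R, 0 < A & forall N, ssum' m xi N <= A ^+ 2 by exists A.
have hp := pairing_lin_r (-1) (sop_range x ht) (sop_range x heta) m0 hu.
move: hp; rewrite -hlin rmorphN rmorph1 mulN1r addrC => <-.
have hin := in_s'_lin (-1) ht heta.
have := normc_pairing_s's (ltW A0) (ltW (mulr_gt0 K0 d0)) hA
  (opnorm_apply (ltW K0) d0 hK hin hN).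
move=> /le_lt_trans; apply.
rewrite (_ : A * _ = e / 2); first lra.
by field; apply/andP; split; rewrite gt_eqF.
Qed.

Lemma pairing_sop_trunc (x : Sop R) xi eta N : in_s' xi ->
  pairing xi (sop x (trunc N eta)) =
  \sum_(0 <= c < N) pairing xi (sop x (evec c)) * Num.conj (eta c).
Proof.
move=> hxi; have /in_s'P[m m0 hA] := hxi.
elim: N => [|N IH].
  rewrite trunc0 sop0 big_nil (@pairing_eventually0 _ _ 0) ?big_nil// => j _.
  by rewrite rmorph0 mulr0.
rewrite truncS sop_lin; [|exact: in_s'_evec|exact: in_s'_trunc].
rewrite (pairing_lin_r _ _ _ m0 hA); first by rewrite IH big_nat_recr //= addrC mulrC.
  by apply: sop_range; exact: in_s'_evec.
by apply: sop_range; exact: in_s'_trunc.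
Qed.

(** Since [adj] is a choice by [epsilon], an adjoint has to be exhibited. Its coordinates are forced
    to be [<xi, x e_c>]; the partial sums of its pairing with [eta] are then the pairings of [xi]
    with [x (trunc N eta)], which converge to [<xi, x eta>]. *)
Lemma adjP (x : Sop R) : is_adjoint (sop x) (adj (sop x)).
Proof.
apply: ClassicalEpsilon.epsilon_spec.
exists (fun xi c => pairing xi (sop x (evec c))) => xi eta hxi heta.
apply: cvgC_lim; rewrite (_ : series _ = fun N => pairing xi (sop x (trunc N eta))).
  exact: cvg_pairing_trunc.
by apply/funext => N; rewrite pairing_sop_trunc.
Qed.

Lemma evec_mul1 c : evec c = fun j => 1 * evec c j.
Proof. by apply/funext => j; rewrite mul1r. Qed.

(** Testing against unit vectors shows that the adjoint is unique on [s'], so the chosen one can be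
    computed. *)
Lemma adj_coord (x : Sop R) xi c : in_s' xi ->
  adj (sop x) xi c = pairing xi (sop x (evec c)).
Proof.
move=> hxi; rewrite -adjP //; last exact: in_s'_evec.
by rewrite evec_mul1 pairing_evec_r rmorph1 mulr1.
Qed.

(** Coordinate [i] of a sequence is the conjugate of its pairing with [evec i], so this is a case of
    [cvg_pairing_trunc]. *)
Lemma cvg_sop_trunc (x : Sop R) eta i : in_s' eta ->
  (fun N => sop x (trunc N eta) i) @ \oo --> sop x eta i.
Proof.
move=> heta; have := cvgC_conj (@cvg_pairing_trunc x _ _ (in_s'_evec i) heta).
have hE v : Num.conj (pairing (evec i) v) = v i.
  by rewrite evec_mul1 pairing_evec_l mul1r; exact: conjcK.
by rewrite hE; under eq_fun do rewrite hE.
Qed.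

End Operators.

(** * Hilbert-Schmidt estimates and the bound for [k = 2n+1] *)

Section UpperBound.
Variable R : realType.
Local Notation C := R[i].
Local Notation normc := (@Normc.normc R).
Implicit Types (xi eta u v : cseq R) (x : Sop R) (l : seq (Sop R)).

Definition entry x (a c : nat) : C := sop x (evec R c) a.

Lemma Re_mul_real (r : R) (z : C) : complex.Re (r%:C%C * z) = r * complex.Re z.
Proof. by case: z => a b /=; rewrite mul0r subr0. Qed.

Lemma cvg_self_pairing u (A : R) : 0 <= A ->
  (forall N, sqsum (fun=> 1) u N <= A ^+ 2) ->
  series (fun j => u j * Num.conj (u j)) @ \oo --> pairing u u.
Proof.
move=> A0 hA; apply: (@cvg_pairing _ (fun=> 1) A A) => // N.
by rewrite /sqsum; under eq_bigr do rewrite invr1; exact: hA.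
Qed.

Lemma sum_sqr_le_self_pairing u (A : R) : 0 <= A ->
  (forall N, sqsum (fun=> 1) u N <= A ^+ 2) ->
  forall N, \sum_(0 <= j < N) normc (u j) ^+ 2 <= complex.Re (pairing u u).
Proof.
move=> A0 hA N; have h := cvgC_Re (cvg_self_pairing A0 hA).
have hE M : complex.Re (series (fun j => u j * Num.conj (u j)) M) =
    \sum_(0 <= j < M) normc (u j) ^+ 2.
  by rewrite /series /= raddf_sum; apply: eq_bigr => j _; rewrite mul_conjc.
rewrite -hE -(cvg_lim _ h)//; apply: nondecreasing_cvgn_le.
  apply/nondecreasing_seqP => M; rewrite !hE big_nat_recr //= lerDl.
  exact: sqr_ge0.
by apply/cvg_ex; eexists; exact: h.
Qed.

Lemma sqsum1_le_ssum n u N : sqsum (fun=> 1) u N <= ssum n u N.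
Proof.
apply: ler_sum => j _; apply: ler_wpM2l; first exact: sqr_ge0.
by rewrite exprn_ege1 ?ler1n.
Qed.

Lemma ssum'_le_sqsum1 n u N : ssum' n u N <= sqsum (fun=> 1) u N.
Proof.
apply: ler_sum => j _; apply: ler_wpM2l; first exact: sqr_ge0.
by rewrite invf_le1 ?exprn_gt0// exprn_ege1 ?ler1n.
Qed.

(** The operator is tested on [evec c], whose dual norm at level [n] is [(c+1)^(-n)]. *)
Lemma entry_le n x (K : R) (a c : nat) : (0 < n)%N -> 0 <= K ->
  (opnorm n (sop x) <= K%:E)%E ->
  normc (entry x a c) ^+ 2 * a.+1%:R ^+ (2 * n) <= K ^+ 2 / c.+1%:R ^+ (2 * n).
Proof.
move=> n0 K0 hK.
have c0 : 0 < (c.+1%:R ^+ n)^-1 :> R by rewrite invr_gt0 exprn_gt0.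
have h1 N : ssum' n (evec R c) N <= (c.+1%:R ^+ n)^-1 ^+ 2.
  rewrite evec_mul1 (le_trans (sqsum_evec_le _ _ _ (sweight'_ge0 R n)))//.
  by rewrite Normc.normc1 expr1n mul1r exprVn -exprM mulnC.
have := opnorm_apply K0 c0 hK (in_s'_evec R c) h1 a.+1.
rewrite exprMn exprVn -exprM mulnC.
apply: le_trans.
exact: (@term_le_sqsum R _ (sop x (evec R c)) a (sweight_ge0 R n)).
Qed.

(** For [xi = t e_a], the real part of [2 <|x|^2 xi, xi>] is [<x xi, x xi> + <x^* xi, x^* xi>]. Here
    [x xi] is [t] times column [a] of the matrix and [x^* xi] is [t] times the conjugate of row [a];
    finite partial sums of the squares stay below the full pairings. *)
Lemma diag_absq_ge x (t : R) (a N : nat) : 0 <= t ->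
  t ^+ 2 * (\sum_(0 <= c < N) normc (entry x c a) ^+ 2 +
            \sum_(0 <= c < N) normc (entry x a c) ^+ 2) <=
  2 * (t * complex.Re (absq (sop x) (fun j => t%:C%C * evec R a j) a)).
Proof.
move=> t0; set xi := fun j => t%:C%C * evec R a j.
have hxi : in_s' xi by apply: in_s'Z; exact: in_s'_evec.
have conjt : Num.conj (t%:C%C) = t%:C%C :> C by exact: conjc_real.
have normt : normc t%:C%C = t by exact: normc_real.
have tE z : normc (t%:C%C * z) ^+ 2 = t ^+ 2 * normc z ^+ 2.
  by rewrite Normc.normcM normt exprMn.
set u := sop x xi; set v := adj (sop x) xi.
have us : in_s u by exact: sop_range.
have [K K0 hK] := sop_bound x (isT : (0 < 1)%N).
have uE c : u c = t%:C%C * entry x c a.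
  by rewrite /u /xi sopZ //; exact: in_s'_evec.
have vE c : v c = t%:C%C * Num.conj (entry x a c).
  by rewrite /v adj_coord // pairing_evec_l.
have [A A0 hA] : exists2 A : R, 0 <= A & forall N, sqsum (fun=> 1) u N <= A ^+ 2.
  have [A A0 hA] := (in_sP u).1 us 1%N isT; exists A; first exact: ltW.
  by move=> M; apply: le_trans (hA M); exact: sqsum1_le_ssum.
(* As [adj] is only a raw operator, square-summability of [v] is read off the decay of row [a] given
   by [entry_le] at level 1. The factor 2 in [B] suffices since the sum of [1/j^2] is at most
   [2 <= 2^2]. *)
have [B B0 hB] : exists2 B : R, 0 <= B & forall N, sqsum (fun=> 1) v N <= B ^+ 2.
  exists (2 * (t * K)); first by rewrite !mulr_ge0 // ltW.
  move=> M; apply: (@le_trans _ _ ((t * K) ^+ 2 * \sum_(0 <= c < M) (c.+1%:R ^+ 2)^-1)).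
    rewrite mulr_sumr; apply: ler_sum => c _.
    rewrite mulr1 vE tE normc_conj exprMn -[leRHS]mulrA.
    apply: ler_wpM2l; first exact: sqr_ge0.
    have := entry_le (n := 1) a c isT (ltW K0) hK; rewrite muln1; apply: le_trans.
    by rewrite ler_peMr ?sqr_ge0// exprn_ege1 ?ler1n.
  rewrite [leRHS]exprMn [leRHS]mulrC; apply: ler_wpM2l; first exact: sqr_ge0.
  by apply: (le_trans (sum_inv_sqr_le R M)); lra.
have vs' : in_s' v.
  apply/in_s'P; exists 1%N => //; exists (B + 1); first lra.
  move=> M; apply: (le_trans (ssum'_le_sqsum1 _ _ _)); apply: (le_trans (hB M)).
  by rewrite ler_sqr ?nnegrE; lra.
have h1 : pairing u u = t%:C%C * adj (sop x) u a.
  rewrite -[RHS]mulrC -[in RHS]conjt -pairing_evec_r -/xi adjP //.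
  exact: in_s_in_s'.
have h2 : pairing v v = t%:C%C * Num.conj (sop x v a).
  by rewrite {1}/v adjP // /xi pairing_evec_l.
have := sum_sqr_le_self_pairing A0 hA N; rewrite h1 Re_mul_real.
have := sum_sqr_le_self_pairing B0 hB N; rewrite h2 Re_mul_real.
under eq_bigr do rewrite vE tE normc_conj.
rewrite -mulr_sumr => hv.
under eq_bigr do rewrite uE tE.
rewrite -mulr_sumr => hu.
rewrite /absq (_ : 2^-1 = (2^-1)%:C%C :> C); last by rewrite fmorphV rmorph_nat.
rewrite Re_mul_real raddfD /= -/xi -/u -/v.
rewrite (_ : complex.Re (Num.conj _) = complex.Re (sop x v a)) in hv; last first.
  by case: (sop x v a).
lra.
Qed.

(** The vector [t e_a] with [t = (a+1)^k] lies in the dual unit ball of level [k]. Coordinate [a] of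
    its image, multiplied by [t], is therefore at most [K] in modulus, and it dominates the row and
    column sums by [diag_absq_ge]. *)
Lemma sum_entries_le l (k a N : nat) (K : R) : 0 <= K ->
  (opnorm k (sum_absq l) <= K%:E)%E ->
  a.+1%:R ^+ (2 * k) *
   \sum_(x <- l) (\sum_(0 <= c < N) normc (entry x c a) ^+ 2 +
            \sum_(0 <= c < N) normc (entry x a c) ^+ 2) <= 2 * K.
Proof.
move=> K0 hK; set t : R := a.+1%:R ^+ k.
have t0 : 0 < t by rewrite exprn_gt0.
have -> : a.+1%:R ^+ (2 * k) = t ^+ 2 by rewrite -exprM mulnC.
set xi := fun j => t%:C%C * evec R a j.
have hxi : in_s' xi by apply: in_s'Z; exact: in_s'_evec.
have h1 M : ssum' k xi M <= 1.
  apply: (le_trans (sqsum_evec_le _ _ _ (sweight'_ge0 R k))).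
  by rewrite normc_real ?(ltW t0)// -exprM mulnC divff // expf_neq0.
have := opnorm_apply1 K0 hK hxi h1 a.+1.
move=> /(le_trans (term_le_sqsum _ _ (sweight_ge0 R k))).
rewrite mulnC exprM -/t -exprMn ler_sqr ?nnegrE ?mulr_ge0 ?normc_ge0 ?(ltW t0)//.
move=> hn; apply: (@le_trans _ _ (2 * (t * complex.Re (sum_absq l xi a)))).
  rewrite /sum_absq raddf_sum !mulr_sumr; apply: ler_sum => x _.
  by apply: diag_absq_ge; exact: ltW.
rewrite ler_pM2l // (le_trans _ hn)// mulrC ler_pM2r //.
by rewrite (le_trans (ler_norm _))// normr_Re_le.
Qed.

(** The squared Hilbert-Schmidt norm of the upper left [N] by [N] corner of [D^n x D^n]. *)
Definition hs n x N : R := \sum_(0 <= a < N) \sum_(0 <= c < N)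
  normc (entry x a c) ^+ 2 * (a.+1%:R ^+ (2 * n) * c.+1%:R ^+ (2 * n)).

Lemma hs_term_ge0 n x a c :
  0 <= normc (entry x a c) ^+ 2 * (a.+1%:R ^+ (2 * n) * c.+1%:R ^+ (2 * n)).
Proof. by rewrite !mulr_ge0 ?exprn_ge0 ?normc_ge0. Qed.

Lemma hs_le n x N M : (N <= M)%N -> hs n x N <= hs n x M.
Proof.
move=> NM; rewrite /hs [leRHS](big_cat_nat (leq0n N) NM) /=.
apply: ler_wpDr.
  by apply: sumr_ge0 => a _; apply: sumr_ge0 => c _; exact: hs_term_ge0.
apply: ler_sum => a _; rewrite [leRHS](big_cat_nat (leq0n N) NM) /= lerDl.
by apply: sumr_ge0 => c _; exact: hs_term_ge0.
Qed.

(* AM-GM [2 a^2n c^2n <= a^4n + c^4n] moves both weights to one index; this is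
   what the diagonal of [|x|^2] controls. *)
Lemma hs_le_diag n x N : 2 * hs n x N <=
  \sum_(0 <= a < N) a.+1%:R ^+ (4 * n) *
    (\sum_(0 <= c < N) normc (entry x c a) ^+ 2 +
     \sum_(0 <= c < N) normc (entry x a c) ^+ 2).
Proof.
under [leRHS]eq_bigr do rewrite mulrDr !mulr_sumr.
rewrite big_split /= exchange_big -big_split /hs mulr_sumr /=.
apply: ler_sum => a _; rewrite -big_split mulr_sumr /=; apply: ler_sum => c _.
have h4 j : j.+1%:R ^+ (4 * n) = (j.+1%:R ^+ (2 * n)) ^+ 2 :> R.
  by rewrite -exprM mulnAC.
rewrite !h4; set p := a.+1%:R ^+ _; set q := c.+1%:R ^+ _.
set e := normc _ ^+ 2; have e0 : 0 <= e by exact: sqr_ge0.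
by have := mulr_ge0 e0 (sqr_ge0 (p - q)); nra.
Qed.

Lemma sum_hs_le n l N (K : R) : 0 <= K ->
  (opnorm (2 * n + 1) (sum_absq l) <= K%:E)%E ->
  \sum_(x <- l) hs n x N <= 2 * K.
Proof.
move=> K0 hK; rewrite -(ler_pM2l (ltr0n R 2)) mulr_sumr.
apply: (le_trans (ler_sum _ (fun x _ => hs_le_diag n x N))).
rewrite exchange_big /=.
apply: (@le_trans _ _ (\sum_(0 <= a < N) (2 * K) * (a.+1%:R ^+ 2)^-1)).
  apply: ler_sum => a _; rewrite -mulr_sumr ler_pdivlMr ?exprn_gt0//.
  (* The level [2n+1] enters here: it controls the weight [(a+1)^(4n+2)], which exceeds the required
     [(a+1)^(4n)] by exactly the summable factor. *)
  rewrite mulrAC -exprD (_ : (4 * n + 2 = 2 * (2 * n + 1))%N).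
    exact: sum_entries_le.
  by rewrite mulnDr mulnA.
rewrite -mulr_sumr mulrC ler_wpM2r ?mulr_ge0//; exact: sum_inv_sqr_le.
Qed.

(** Finiteness of the norm at level [n+1] gains two powers in each index: the terms are at most
    [K^2 (a+1)^(-2) (c+1)^(-2)], and each of the two sums contributes a factor 2. *)
Lemma cvg_hs n x : cvgn (hs n x).
Proof.
apply: nondecreasing_is_cvgn; first by move=> N M; exact: hs_le.
have [K K0 hK] := sop_bound x (isT : (0 < n.+1)%N).
exists (K ^+ 2 * (2 * 2)) => _ [N _ <-]; rewrite /hs.
apply: (@le_trans _ _ (\sum_(0 <= a < N) \sum_(0 <= c < N)
    K ^+ 2 * ((a.+1%:R ^+ 2)^-1 * (c.+1%:R ^+ 2)^-1))).
  apply: ler_sum => a _; apply: ler_sum => c _.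
  have := entry_le (n := n.+1) a c isT (ltW K0) hK.
  rewrite mulnS addnC !exprD => h.
  rewrite [leRHS]mulrA ler_pdivlMr ?exprn_gt0// ler_pdivlMr ?exprn_gt0//.
  move: h; rewrite ler_pdivlMr ?mulr_gt0 ?exprn_gt0//; apply: le_trans.
  by rewrite le_eqVlt; apply/orP; left; apply/eqP; ring.
under eq_bigr do rewrite -mulr_sumr -mulr_sumr.
rewrite -mulr_sumr -mulr_suml ler_wpM2l ?sqr_ge0//.
have h0 : 0 <= \sum_(0 <= c < N) (c.+1%:R ^+ 2)^-1 :> R.
  by apply: sumr_ge0 => c _; rewrite invr_ge0 sqr_ge0.
by apply: ler_pM => //; exact: sum_inv_sqr_le.
Qed.

Definition hsnorm2 n x : R := limn (hs n x).

Lemma hs_le_hsnorm2 n x N : hs n x N <= hsnorm2 n x.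
Proof.
by apply: nondecreasing_cvgn_le; [move=> M M'; exact: hs_le | exact: cvg_hs].
Qed.

Lemma hsnorm2_ge0 n x : 0 <= hsnorm2 n x.
Proof. by apply: le_trans (hs_le_hsnorm2 n x 0); rewrite /hs big_nil. Qed.

(** On truncated inputs this is Cauchy-Schwarz in each row, with the terms split as [xi_c / (c+1)^n]
    times [x(a,c) (c+1)^n]. The number [M] of output coordinates is kept fixed while the truncation
    index [N >= M] goes to infinity. *)
Lemma opnorm_le_hs n x : (opnorm n (sop x) <= (Num.sqrt (hsnorm2 n x))%:E)%E.
Proof.
apply: opnorm_le; first exact: sqrtr_ge0.
move=> xi hxi h1 M; rewrite sqr_sqrtr ?hsnorm2_ge0//.
have hc : (fun N => ssum n (sop x (trunc N xi)) M) @ \oo --> ssum n (sop x xi) M.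
  rewrite /ssum /sqsum; elim: M => [|M IH].
    under eq_fun do rewrite big_nil.
    by rewrite big_nil; exact: cvg_cst.
  under eq_fun do rewrite big_nat_recr //=.
  rewrite big_nat_recr //=; apply: cvgD => //; apply: cvgM; last exact: cvg_cst.
  by apply: cvgC_normc_sqr; exact: cvg_sop_trunc.
rewrite -(cvg_lim _ hc)//; apply: limr_le; first by apply/cvg_ex; eexists; exact: hc.
near=> N; apply: le_trans (hs_le_hsnorm2 n x N).
have MN : (M <= N)%N by near: N; exact: nbhs_infty_ge.
apply: (le_trans (sqsum_le _ (sweight_ge0 R n) MN)).
apply: ler_sum => a _; rewrite sop_trunc.
under [leRHS]eq_bigr do rewrite mulrCA.
rewrite -mulr_sumr mulrC; apply: ler_wpM2l; first exact: sweight_ge0.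
have h2 : normc (\sum_(0 <= c < N) xi c * sop x (evec R c) a) <=
    \sum_(0 <= c < N) normc (xi c) * normc (entry x a c).
  elim/big_ind2 : _ => //; first by rewrite Normc.normc0.
    by move=> y b z d hy hz; rewrite (le_trans (le_normcD _ _))// lerD.
  by move=> c _; rewrite Normc.normcM.
apply: (@le_trans _ _ ((\sum_(0 <= c < N) (normc (xi c) / c.+1%:R ^+ n) *
    (normc (entry x a c) * c.+1%:R ^+ n)) ^+ 2)).
  rewrite ler_sqr ?nnegrE ?normc_ge0//; last first.
    by apply: sumr_ge0 => c _; rewrite !mulr_ge0 ?invr_ge0 ?normc_ge0 ?exprn_ge0.
  apply: (le_trans h2); apply: ler_sum => c _.
  by rewrite le_eqVlt; apply/orP; left; apply/eqP; field; rewrite expf_neq0.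
apply: (le_trans (sum_mul_sqr_le _ _ _)).
rewrite (_ : \sum_(0 <= j < N) (normc (xi j) / _) ^+ 2 = ssum' n xi N); last first.
  by apply: eq_bigr => c _; rewrite exprMn exprVn -exprM mulnC.
apply: (le_trans (ler_wpM2r _ (h1 N))).
  by apply: sumr_ge0 => c _; exact: sqr_ge0.
rewrite mul1r; apply: ler_sum => c _.
by rewrite exprMn -exprM mulnC.
Unshelve. all: by end_near. Qed.

Lemma sum_hsnorm2_le n l :
  ((\sum_(x <- l) hsnorm2 n x)%:E <= 2%:E * opnorm (2 * n + 1) (sum_absq l))%E.
Proof.
have := opnorm_ge0 (2 * n + 1) (sum_absq l).
(* An infinite norm makes the right side infinite; a finite one bounds every corner, and the bound
   passes to the limit. *)
case E : (opnorm _ _) => [K| |] // K0; last by rewrite gt0_muley ?leey// lte_fin.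
rewrite -EFinM lee_fin.
have hc : (fun N => \sum_(x <- l) hs n x N) @ \oo --> \sum_(x <- l) hsnorm2 n x.
  elim: l {E} => [|x l IH].
    under eq_fun do rewrite big_nil.
    by rewrite big_nil; exact: cvg_cst.
  under eq_fun do rewrite big_cons.
  by rewrite big_cons; apply: cvgD => //; exact: cvg_hs.
rewrite -(cvg_lim _ hc)//; apply: limr_le; first by apply/cvg_ex; eexists; exact: hc.
by near=> N; apply: sum_hs_le => //; rewrite E.
Unshelve. all: by end_near. Qed.

Lemma ratio_bounded_2n1 n : ratio_bounded R n (2 * n + 1).
Proof.
(* Each representation [L'] competing in [ah_norm] is used unchanged in [pi_norm]. The constant 2 is
   [sqrt 2 * sqrt 2], one factor for each tensor leg, from [sum_hsnorm2_le]. *)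
exists 2; split => // L _; rewrite -lee_pdivrMl //; apply/ereal_infP => _ [L' hL' <-].
rewrite lee_pdivrMl //.
apply: (@le_trans _ _ (\sum_(p <- L') (opnorm n (sop p.1) * opnorm n (sop p.2)))%E).
  by apply: ereal_inf_lbound; exists L'.
set S1 := map fst L'; set S2 := map snd L'.
apply: (@le_trans _ _ ((Num.sqrt (\sum_(x <- S1) hsnorm2 n x) *
    Num.sqrt (\sum_(x <- S2) hsnorm2 n x))%:E)).
  apply: (@le_trans _ _ (\sum_(p <- L') (Num.sqrt (hsnorm2 n p.1) *
    Num.sqrt (hsnorm2 n p.2))%:E)%E).
    apply: lee_sum => p _; rewrite EFinM.
    by apply: lee_pmul; rewrite ?opnorm_ge0 ?opnorm_le_hs.
  rewrite sumEFin lee_fin; apply: sum_mul_le; rewrite ?sqrtr_ge0//.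
    rewrite sqr_sqrtr ?big_map; last by apply: sumr_ge0 => x _; exact: hsnorm2_ge0.
    by apply: ler_sum => p _; rewrite sqr_sqrtr ?hsnorm2_ge0.
  rewrite sqr_sqrtr ?big_map; last by apply: sumr_ge0 => x _; exact: hsnorm2_ge0.
  by apply: ler_sum => p _; rewrite sqr_sqrtr ?hsnorm2_ge0.
have hS (S : seq (Sop R)) : ((Num.sqrt (\sum_(x <- S) hsnorm2 n x))%:E <=
    (Num.sqrt 2)%:E * sqrte (opnorm (2 * n + 1) (sum_absq S)))%E.
  rewrite -[(Num.sqrt 2)%:E]/(sqrte 2%:E) -sqrteM ?lee_fin//.
  rewrite -[leLHS]/(sqrte (_)%:E) lee_sqrt; first exact: sum_hsnorm2_le.
  by rewrite mule_ge0 ?lee_fin ?opnorm_ge0.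
rewrite EFinM; apply: le_trans (lee_pmul _ _ (hS S1) (hS S2)) _.
1,2: by rewrite lee_fin sqrtr_ge0.
by rewrite muleACA -EFinM -expr2 sqr_sqrtr.
Qed.

End UpperBound.

(** * Matrix units and the failure for [k <= 2n] *)

Section MatrixUnits.
Variable R : realType.
Local Notation C := R[i].
Local Notation normc := (@Normc.normc R).
Implicit Types (xi eta u v : cseq R) (x : Sop R).

Definition munit_fun (a b : nat) : rawop R := fun xi i => xi b * evec R a i.

Lemma munit_lin a b : linear_on_s' (munit_fun a b).
Proof. by move=> z xi eta _ _; apply/funext => i; rewrite /munit_fun; ring. Qed.

Lemma munit_range a b xi : in_s' xi -> in_s (munit_fun a b xi).
Proof.
move=> _; apply/in_sP => n n0.
have h0 : 0 <= normc (xi b) * a.+1%:R ^+ n by rewrite mulr_ge0 ?normc_ge0 ?exprn_ge0.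
exists (normc (xi b) * a.+1%:R ^+ n + 1); first lra.
move=> N; apply: (le_trans (sqsum_evec_le _ _ _ (sweight_ge0 R n))).
rewrite mulnC exprM -exprMn; move: h0; set T := normc _ * _; nra.
Qed.

Lemma munit_opnorm n a b :
  (opnorm n (munit_fun a b) <= (a.+1%:R ^+ n * b.+1%:R ^+ n)%:E)%E.
Proof.
apply: opnorm_le; first by rewrite mulr_ge0 ?exprn_ge0.
move=> xi _ h1 N; apply: (le_trans (sqsum_evec_le _ _ _ (sweight_ge0 R n))).
rewrite exprMn -!exprM mulrC (mulnC n); apply: ler_wpM2l; first exact: exprn_ge0.
have := le_trans (term_le_sqsum xi b (sweight'_ge0 R n)) (h1 b.+1).
by rewrite ler_pdivrMr ?exprn_gt0// mul1r.
Qed.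

Lemma munit_cont a b n : (0 < n)%N -> (opnorm n (munit_fun a b) < +oo)%E.
Proof. by move=> _; apply: (le_lt_trans (munit_opnorm n a b)); exact: ltry. Qed.

Definition munit a b : Sop R :=
  MkSop (@munit_lin a b) (@munit_range a b) (@munit_cont a b).

Lemma evec_diag (a : nat) : evec R a a = 1.
Proof. by rewrite /evec eqxx. Qed.

Lemma adj_munit a b xi : in_s' xi ->
  adj (sop (munit a b)) xi = (fun i => xi a * evec R b i).
Proof.
move=> hxi; apply/funext => c; rewrite adj_coord // /= /munit_fun.
rewrite pairing_evec_r /evec eq_sym; congr (_ * _); exact: conjc_nat.
Qed.

Lemma absq_munit a b xi i : in_s' xi ->
  absq (sop (munit a b)) xi i =
  2^-1 * (xi b * evec R b i + xi a * evec R a i).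
Proof.
move=> hxi; rewrite /absq !adj_munit //; last exact/in_s_in_s'/munit_range.
by rewrite /= /munit_fun !evec_diag !mulr1.
Qed.

Lemma sum_evec_seq (s : seq nat) xi i : uniq s ->
  \sum_(b <- s) xi b * evec R b i = (i \in s)%:R * xi i.
Proof.
move=> us; have [is_|nis] := boolP (i \in s).
  rewrite (bigD1_seq i) //= big1 => [|b /negbTE bi]; last first.
    by rewrite /evec eq_sym bi mulr0.
  by rewrite evec_diag addr0 mulr1 mul1r.
rewrite mul0r big_seq big1 // => b bs; rewrite /evec.
by case: eqP => [ib|_]; [rewrite ib bs in nis | rewrite mulr0].
Qed.

(** Each [|e_(ab)|^2] is half of [e_(bb) + e_(aa)]. Over [b] in [s] the first terms add up to the
    coordinate projection onto [s], while [e_(aa)] is repeated [size s] times. *)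
Lemma sum_absq_munit a (s : seq nat) xi i : in_s' xi -> uniq s ->
  sum_absq (map (munit a) s) xi i =
  (2^-1 * ((i \in s)%:R + (size s)%:R * (i == a)%:R))%:C%C * xi i.
Proof.
move=> hxi us; rewrite /sum_absq big_map.
under eq_bigr do rewrite absq_munit //.
rewrite -mulr_sumr big_split /= sum_evec_seq // big_const_seq iter_addr_0 count_predT.
rewrite rmorphM rmorphD rmorphM !rmorph_nat fmorphV rmorph_nat -mulrA mulrDl.
congr (_ * (_ + _)); rewrite -[LHS]mulr_natl -[RHS]mulrA /evec; congr (_ * _).
by case: eqP => [->|_]; rewrite ?mulr1 ?mul1r ?mulr0 ?mul0r.
Qed.

(** A diagonal operator is bounded at level [k] by any bound for its entries [d_i] multiplied by
    [(i+1)^(2k)]. The window [i < 2N] gives [i+1 <= 2N], and the repeated entry sits at [i = a]. *)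
Lemma opnorm_sum_absq_munit k a (N : nat) :
  (opnorm k (sum_absq (map (munit a) (index_iota N (2 * N)))) <=
   ((2 * N)%:R ^+ (2 * k) + N%:R * a.+1%:R ^+ (2 * k))%:E)%E.
Proof.
set B : R := (_ + _).
have B1 : 0 <= (2 * N)%:R ^+ (2 * k) :> R by exact: exprn_ge0.
have B2 : 0 <= N%:R * a.+1%:R ^+ (2 * k) :> R by rewrite mulr_ge0 ?exprn_ge0.
have B0 : 0 <= B by exact: addr_ge0.
apply: opnorm_le => // xi hxi h1 M.
apply: le_trans (ler_piMr (sqr_ge0 B) (h1 M)); rewrite mulr_sumr.
apply: ler_sum => i _; rewrite sum_absq_munit ?iota_uniq //.
have -> : size (index_iota N (2 * N)) = N by rewrite size_iota mul2n -addnn addnK.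
set d := 2^-1 * _; set w := i.+1%:R ^+ _.
have w0 : 0 < w by exact: exprn_gt0.
have d0 : 0 <= d by rewrite mulr_ge0 ?invr_ge0// addr_ge0// mulr_ge0.
have dw : d * w <= B.
  have -> : d * w = 2^-1 * ((i \in index_iota N (2 * N))%:R * w +
      N%:R * ((i == a)%:R * w)) by rewrite /d; ring.
  have h2 : (i \in index_iota N (2 * N))%:R * w <= (2 * N)%:R ^+ (2 * k).
    case: (boolP (i \in _)) => [|_]; last by rewrite mul0r.
    rewrite mul1r mem_index_iota => /andP[_ iN].
    by rewrite lerXn2r ?nnegrE// ler_nat.
  have h3 : N%:R * ((i == a)%:R * w) <= N%:R * a.+1%:R ^+ (2 * k).
    apply: ler_wpM2l => //; rewrite /w.
    by case: eqP => [->|_]; rewrite ?mul1r ?mul0r ?exprn_ge0.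
  by rewrite /B; lra.
rewrite Normc.normcM normc_real // exprMn -/w; set e := normc (xi i) ^+ 2.
have -> : d ^+ 2 * e * w = (d * w) ^+ 2 * (e * w^-1) by field; rewrite gt_eqF.
apply: ler_wpM2r; first by rewrite mulr_ge0 ?sqr_ge0// invr_ge0 ltW.
by rewrite ler_sqr ?nnegrE// mulr_ge0 // ltW.
Qed.

(** * Norms of tensors supported on a single row *)

Definition row2 a (N : nat) x : R :=
  \sum_(N <= b < 2 * N) normc (entry x a b) ^+ 2.

(** The test vector is the conjugate of row [a] restricted to the window. Coordinate [a] of its
    image is [S = row2 a N x], and its dual norm is at most [sqrt S / N^n] because all weights in
    the window are at least [N]. Dividing by [sqrt S] gives the bound. *)
Lemma row2_le n a (N : nat) x (K : R) : (0 < N)%N -> 0 <= K ->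
  (opnorm n (sop x) <= K%:E)%E ->
  Num.sqrt (row2 a N x) * (a.+1%:R ^+ n * N%:R ^+ n) <= K.
Proof.
move=> N0 K0 hK; set S := row2 a N x.
have S0 : 0 <= S by apply: sumr_ge0 => b _; exact: sqr_ge0.
have [->|Sn0] := eqVneq S 0; first by rewrite sqrtr0 mul0r.
have Sp : 0 < S by rewrite lt_def Sn0.
have NN : (N <= 2 * N)%N by rewrite leq_pmull.
have Nn0 : 0 < N%:R ^+ n :> R by rewrite exprn_gt0 // ltr0n.
have an0 : 0 < a.+1%:R ^+ n :> R by rewrite exprn_gt0.
pose eta : cseq R := fun b => if (N <= b)%N then Num.conj (entry x a b) else 0.
have hxi := in_s'_trunc (2 * N) eta; set xi := trunc _ _ in hxi.
have xia : sop x xi a = S%:C%C.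
  rewrite sop_trunc (big_cat_nat (leq0n N) NN) /= big_nat_cond big1 ?add0r; last first.
    by move=> b /andP[/andP[_ bN] _]; rewrite /eta leqNgt bN mul0r.
  rewrite /S /row2 rmorph_sum; apply: eq_big_nat => b /andP[Nb _].
  by rewrite /eta Nb mulrC mul_conjc.
have A0 : 0 < Num.sqrt S / N%:R ^+ n by rewrite divr_gt0 ?sqrtr_gt0.
have hA M : ssum' n xi M <= (Num.sqrt S / N%:R ^+ n) ^+ 2.
  apply: (le_trans (sqsum_le _ (sweight'_ge0 R n) (leq_maxr (2 * N) M))).
  rewrite /sqsum (big_cat_nat (leq0n N) (leq_trans NN (leq_maxl _ M))) /=.
  rewrite big_nat_cond big1 ?add0r; last first.
    move=> b /andP[/andP[_ bN] _].
    by rewrite /xi /trunc /eta (leqNgt N) bN if_same Normc.normc0 expr0n mul0r.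
  rewrite (big_cat_nat NN (leq_maxl _ M)) /= [X in _ + X]big_nat_cond.
  rewrite [X in _ + X]big1 ?addr0; last first.
    move=> b /andP[/andP[Nb _] _].
    by rewrite /xi /trunc ltnNge Nb Normc.normc0 expr0n mul0r.
  rewrite exprMn sqr_sqrtr // mulr_suml.
  rewrite big_nat_cond [leRHS]big_nat_cond.
  apply: ler_sum => b /andP[/andP[Nb bN] _].
  rewrite /xi /trunc bN /eta Nb normc_conj; apply: ler_wpM2l; first exact: sqr_ge0.
  rewrite exprVn -exprM mulnC lef_pV2 ?posrE ?exprn_gt0 ?ltr0n//.
  by rewrite lerXn2r ?nnegrE// ler_nat leqW.
have := opnorm_apply K0 A0 hK hxi hA a.+1.
move=> /(le_trans (term_le_sqsum _ a (sweight_ge0 R n))).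
rewrite xia normc_real // mulnC exprM -exprMn.
rewrite ler_sqr ?nnegrE ?mulr_ge0// ?(ltW an0) ?(ltW A0)//.
set r := Num.sqrt S; have r0 : 0 < r by rewrite sqrtr_gt0.
rewrite [X in _ <= X -> _]mulrA ler_pdivlMr // -(sqr_sqrtr S0) -/r => h.
rewrite -(ler_pM2l r0) [leRHS]mulrC; apply: le_trans h.
by rewrite le_eqVlt; apply/orP; left; apply/eqP; ring.
Qed.

(** With indices from 0, the columns of the window carry the weights [N+1] to [2N] and the row
    carries the weight [a+1]. *)
Definition row_tensor a (N : nat) : seq (Sop R * Sop R) :=
  [seq (munit a b, munit a b) | b <- index_iota N (2 * N)].

Lemma tens_eval_row_tensor a N b : (N <= b < 2 * N)%N ->
  tens_eval (row_tensor a N) (evec R b) (evec R b) a a = 1.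
Proof.
move=> hb; rewrite /tens_eval big_map (bigD1_seq b) ?iota_uniq ?mem_index_iota//=.
rewrite big1 /munit_fun ?evec_diag ?mul1r ?addr0// => c /negbTE cb.
by rewrite /evec cb !mul0r.
Qed.

Lemma row_tensor_nonzero a N : (0 < N)%N -> tensor_nonzero (row_tensor a N).
Proof.
move=> N0; exists (evec R N), (evec R N), a, a.
split; [exact: in_s'_evec|exact: in_s'_evec|].
rewrite tens_eval_row_tensor; first exact/eqP/oner_neq0.
by rewrite leqnn /= mul2n -addnn -ltn_subLR // subnn.
Qed.

(** The value 1 at [(e_b, e_b)] in coordinates [(a, a)] is the same for every representation. Adding
    up its moduli over the [N] columns, exchanging the sums and using Cauchy-Schwarz in [b] bounds
    [N] by the sum over pairs of products of row norms, which [row2_le] compares with operator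
    norms. *)
Lemma pi_norm_row_tensor_ge n a N : (0 < n)%N -> (0 < N)%N ->
  ((N%:R * (a.+1%:R ^+ n * N%:R ^+ n) ^+ 2)%:E <= pi_norm n (row_tensor a N))%E.
Proof.
move=> n0 N0; apply/ereal_infP => _ [L' hL' <-].
set q : R := a.+1%:R ^+ n * N%:R ^+ n.
have q0 : 0 <= q by rewrite mulr_ge0 ?exprn_ge0.
apply: (@le_trans _ _ (\sum_(p <- L') ((Num.sqrt (row2 a N p.1) * q) *
    (Num.sqrt (row2 a N p.2) * q))%:E)%E); last first.
  apply: lee_sum => p _; rewrite EFinM.
  have hx x : ((Num.sqrt (row2 a N x) * q)%:E <= opnorm n (sop x))%E.
    have := opnorm_ge0 n (sop x); have := sop_cont x n0.
    case E : (opnorm _ _) => [K| |] // _ K0; rewrite lee_fin.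
    by apply: (row2_le (n := n)) => //; rewrite E.
  by apply: lee_pmul => //; rewrite lee_fin mulr_ge0 ?sqrtr_ge0.
rewrite sumEFin lee_fin.
under eq_bigr do rewrite mulrACA -expr2.
rewrite -mulr_suml ler_wpM2r ?sqr_ge0//.
apply: (@le_trans _ _ (\sum_(N <= b < 2 * N) \sum_(p <- L')
    normc (entry p.1 a b) * normc (entry p.2 a b))).
  apply: (@le_trans _ _ (\sum_(N <= b < 2 * N) 1)).
    by rewrite sumr_const_nat mul2n -addnn addnK.
  rewrite big_nat_cond [leRHS]big_nat_cond.
  apply: ler_sum => b /andP[hb _].
  have hE := hL' _ _ a a (in_s'_evec R b) (in_s'_evec R b).
  rewrite tens_eval_row_tensor // in hE.
  rewrite -(Normc.normc1 R) -hE /tens_eval.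
  elim/big_ind2 : _ => //; first by rewrite Normc.normc0.
    by move=> y c z d hy hz; rewrite (le_trans (le_normcD _ _))// lerD.
  by move=> p _; rewrite Normc.normcM.
rewrite exchange_big; apply: ler_sum => p _.
by apply: sum_mul_le; rewrite ?sqrtr_ge0// sqr_sqrtr //;
  apply: sumr_ge0 => b _; exact: sqr_ge0.
Qed.

(** The defining representation is used; its two legs coincide, so the product of the square roots
    is the norm itself. *)
Lemma ah_norm_row_tensor_le k a N :
  (ah_norm k (row_tensor a N) <=
   ((2 * N)%:R ^+ (2 * k) + N%:R * a.+1%:R ^+ (2 * k))%:E)%E.
Proof.
set B : R := (_ + _).
have hE : (sqrte (opnorm k (sum_absq (map (munit a) (index_iota N (2 * N))))) <=
    sqrte B%:E)%E.
  by rewrite lee_sqrt ?opnorm_sum_absq_munit// lee_fin addr_ge0 ?mulr_ge0 ?exprn_ge0.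
apply: le_trans (_ : _ <= sqrte B%:E * sqrte B%:E)%E _; last first.
  rewrite -EFinM -expr2 sqr_sqrtr //.
  by rewrite addr_ge0 ?mulr_ge0 ?exprn_ge0.
apply: le_trans (lee_pmul (sqrte_ge0 _) (sqrte_ge0 _) hE hE).
apply: ereal_inf_lbound; exists (row_tensor a N) => //.
by rewrite /row_tensor -!map_comp.
Qed.

(* With [N = t^(4n)] and [a + 1 = t^(4n-1)] both terms bounding [||z||_{ah,2n}]
   have order [t^(16n^2)], while [||z||_{pi,n} >= t^(16n^2 + 2n)]. *)
Lemma ratio_bounded_ge n k : (0 < n)%N -> ratio_bounded R n k ->
  (2 * n + 1 <= k)%N.
Proof.
move=> n0 [M [M0 hM]]; rewrite addn1 ltnNge; apply/negP => kn.
have key (t : nat) : (0 < t)%N -> t%:R ^+ (2 * n) <= M * (2 ^+ (4 * n) + 1).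
  move=> t0; pose N := (t ^ (4 * n))%N; pose a := (t ^ (4 * n).-1).-1.
  have N0 : (0 < N)%N by rewrite expn_gt0 t0.
  have aE : a.+1 = (t ^ (4 * n).-1)%N by rewrite prednK // expn_gt0 t0.
  have := hM _ (row_tensor_nonzero a N0).
  move=> /(le_trans (pi_norm_row_tensor_ge a n0 N0)) h.
  have M0e : (0 <= M%:E)%E by rewrite lee_fin ltW.
  have := le_trans h (lee_wpmul2l M0e (ah_norm_row_tensor_le k a N)).
  rewrite -EFinM lee_fin aE /N !natrX natrM natrX.
  set T : R := t%:R; have T1 : 1 <= T by rewrite ler1n.
  have T0 : 0 < T by lra.
  (* Both sides of the estimate are compared through this common power, which cancels and leaves
     [T ^+ (2 * n)] bounded independently of [t]. *)
  have Tn0 : 0 < T ^+ (16 * n * n) by rewrite exprn_gt0.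
  have n4 : ((4 * n).-1 + 1 = 4 * n)%N by rewrite addn1 prednK // muln_gt0.
  have -> : T ^+ (4 * n) * (T ^+ (4 * n).-1 ^+ n * T ^+ (4 * n) ^+ n) ^+ 2 =
      T ^+ (2 * n) * T ^+ (16 * n * n).
    rewrite -!exprM -exprD -exprM -!exprD; congr (_ ^+ _); nia.
  move=> h1; rewrite -(ler_pM2r Tn0); apply: (le_trans h1).
  rewrite -mulrA ler_pM2l // [leRHS]mulrDl mul1r.
  have kn2 : (2 * k <= 4 * n)%N by lia.
  apply: lerD.
    apply: (@le_trans _ _ ((2 * T ^+ (4 * n)) ^+ (4 * n))).
      by rewrite ler_weXn2l // mulr_ege1 ?ler1n// exprn_ege1.
    rewrite exprMn -exprM (_ : (4 * n * (4 * n) = 16 * n * n)%N) //; nia.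
  (* The exponent [4n + 2k(4n-1)] is at most [4n + 4n(4n-1) = 16n^2]; equality at [k = 2n] is what
     dictates the choice of [4n-1]. *)
  rewrite -!exprM -exprD ler_weXn2l //; nia.
pose c := M * (2 ^+ (4 * n) + 1).
have [t ht] : exists t : nat, c < t%:R.
  exists (Num.bound c); apply: archi_boundP.
  by rewrite mulr_ge0 ?(ltW M0)// addr_ge0 ?exprn_ge0.
have := key t.+1 isT; rewrite leNgt => /negP; apply.
apply: (lt_le_trans ht); apply: (@le_trans _ _ t.+1%:R); first by rewrite ler_nat.
by rewrite -{1}[t.+1%:R]expr1 ler_weXn2l ?ler1n// muln_gt0.
Qed.

End MatrixUnits.

Theorem theorem3p3 (R : realType) (n : nat) : (0 < n)%N ->
  ratio_bounded R n (2 * n + 1) /\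
  (forall k : nat, (0 < k)%N -> ratio_bounded R n k -> (2 * n + 1 <= k)%N).
Proof.
move=> n0; split; first exact: ratio_bounded_2n1.
by move=> k _; exact: ratio_bounded_ge.
Qed.
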